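(* Let $(G,B,m,w)$ be a weighted finite graph with boundary. Then $\nu_i\ge \mu_i$ for every $i=1,2,\dots,|\Omega|$. Moreover, if $\mu_i=\nu_i>0$ for some $i\in\{2,\dots,|\Omega|\}$, then there is a function $u\in\mathbb{R}^V$ such that $u|_B=\frac{\partial u}{\partial n}=0$ on $B$ and $u$ is simultaneously a Laplacian eigenfunction and a Neumann Laplacian eigenfunction for the eigenvalue $\nu_i=\mu_i$ (that is, $u|_\Omega\neq 0$, $\Delta u=\mu_i u$ on $V$, and $\Delta^N(u|_\Omega)=\nu_i\, u|_\Omega$).
   Context: A weighted finite graph $(G,m,w)$ is a finite simple graph $G$ with vertex set $V$ and edge set $E$, a vertex-measure $m:V\to(0,\infty)$ and an edge-weight $w:E\to(0,\infty)$; $w$ is extended to a symmetric function on $V\times V$ by $w_{xy}=0$ when $\{x,y\}\notin E$. A weighted finite graph with boundary $(G,B,m,w)$ is a weighted finite graph with a nonempty subset $B\subset V$ (the boundary); $\Omega=V\setminus B$ is the interior. $\mathbb{R}^S$ is the space of real functions on $S$, with inner product $\langle u,v\rangle_S=\sum_{x\in S}u(x)v(x)m_x$. Laplacian: $\Delta u(x)=\frac1{m_x}\sum_{y\in V}(u(x)-u(y))w_{xy}$ for $u\in\mathbb{R}^V$, $x\in V$; its eigenvalues, counted with multiplicity, are $0=\mu_1\le\mu_2\le\dots\le\mu_{|V|}$. For $x\in B$, the normal derivative is $\frac{\partial u}{\partial n}(x)=\frac1{m_x}\sum_{y\in V}(u(x)-u(y))w_{xy}=\Delta u(x)$. Neumann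 Laplacian: for $u\in\mathbb{R}^\Omega$, let $N_0(u)\in\mathbb{R}^V$ be the function with $N_0(u)=u$ on $\Omega$, $\Delta N_0(u)=0$ on $B$, and $N_0(u)=0$ on the connected components of $G$ containing no vertex of $\Omega$ (this is unique). Set $\Delta^N u=(\Delta N_0(u))|_\Omega$. This is a nonnegative self-adjoint operator on $\mathbb{R}^\Omega$ with eigenvalues (the Neumann eigenvalues), counted with multiplicity, $0\le\nu_1\le\nu_2\le\dots\le\nu_{|\Omega|}$. *)

(* Defs.v *)
From HB Require Import structures.
From mathcomp Require Import all_boot all_order all_algebra.
From mathcomp Require Import polyrcf.
From mathcomp Require Import reals.

Set Implicit Arguments.
Unset Strict Implicit.
Unset Printing Implicit Defensive.

Import Order.TTheory GRing.Theory Num.Theory.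
Local Open Scope ring_scope.

(* The edge-weight is directly its extension by zero to V * V. *)
Record wgraph (R : rcfType) (V : finType) := WGraph {
  adj : rel V;
  adj_sym : symmetric adj;
  adj_irr : irreflexive adj;
  vmeas : V -> R;
  vmeas_gt0 : forall x, 0 < vmeas x;
  ewt : V -> V -> R;
  ewt_sym : forall x y, ewt x y = ewt y x;
  ewt_gt0 : forall x y, adj x y -> 0 < ewt x y;
  ewt_eq0 : forall x y, ~~ adj x y -> ewt x y = 0
}.

Section Eigen.
Variables (R : rcfType) (T : finType).
Implicit Types (f : {ffun T -> R} -> {ffun T -> R}).

(* Row i holds the image of the i-th vector of the standard basis of R^T, so
   this is the transpose of the column-convention matrix of f; both have the
   same characteristic polynomial. *)
Definition op_mx f : 'M[R]_#|T| :=
  \matrix_(i, j) f [ffun x => (x == enum_val i)%:R] (enum_val j).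

(* rootsR lists the distinct real roots in increasing order; each one is
   repeated according to its multiplicity in the characteristic polynomial. *)
Definition eigenvalues f : seq R :=
  let p := char_poly (op_mx f) in
  flatten [seq nseq (mup a p) a | a <- rootsR p].

(* Indices start at 1. *)
Definition nth_eigenvalue f (i : nat) : R := (eigenvalues f)`_i.-1.

Definition is_eigenfunction f (c : R) (u : {ffun T -> R}) : Prop :=
  u != 0 /\ forall x, f u x = c * u x.

End Eigen.

Section Graph.
Variables (R : rcfType) (V : finType) (G : wgraph R V).
Implicit Types (u U : {ffun V -> R}) (x y : V).

Definition laplacian U : {ffun V -> R} :=
  [ffun x => (vmeas G x)^-1 * \sum_y (U x - U y) * ewt G x y].

Definition normal_derivative U x : R :=
  (vmeas G x)^-1 * \sum_y (U x - U y) * ewt G x y.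

Lemma dirichlet_energy U :
  \sum_x U x * laplacian U x * vmeas G x
  = 2^-1 * \sum_x \sum_y (U x - U y) ^+ 2 * ewt G x y.
Proof.
have E1 : \sum_x U x * laplacian U x * vmeas G x
          = \sum_x \sum_y U x * (U x - U y) * ewt G x y.
  apply: eq_bigr => x _; rewrite ffunE mulrA mulrAC -(mulrA (U x)) mulVf.
    by rewrite mulr1 mulr_sumr; apply: eq_bigr => y _; rewrite mulrA.
  by rewrite gt_eqF ?vmeas_gt0.
have E2 : \sum_x U x * laplacian U x * vmeas G x
          = \sum_x \sum_y U y * (U y - U x) * ewt G x y.
  rewrite E1 exchange_big; apply: eq_bigr => x _; apply: eq_bigr => y _.
  by rewrite ewt_sym.
apply: (mulfI (_ : 2 != 0 :> R)); first by rewrite pnatr_eq0.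
rewrite mulrA divff ?pnatr_eq0 // mul1r mulr_natl mulr2n {1}E1 E2 -big_split.
apply: eq_bigr => x _; rewrite -big_split; apply: eq_bigr => y _ /=.
by rewrite -mulrDl -[U y - U x]opprB mulrN -mulrBl expr2.
Qed.

Lemma harmonic_constant U :
  (forall x, U x * laplacian U x = 0) ->
  forall x y, connect (adj G) x y -> U x = U y.
Proof.
move=> h0.
have w_ge0 x y : 0 <= ewt G x y.
  by have [/ewt_gt0/ltW//|/ewt_eq0->] := boolP (adj G x y).
have t_ge0 x y : 0 <= (U x - U y) ^+ 2 * ewt G x y.
  by rewrite mulr_ge0 ?sqr_ge0.
have /eqP : 2^-1 * \sum_x \sum_y (U x - U y) ^+ 2 * ewt G x y = 0.
  by rewrite -dirichlet_energy big1 // => x _; rewrite h0 mul0r.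
rewrite mulf_eq0 invr_eq0 pnatr_eq0 /= => /eqP.
move=> /psumr_eq0P s0.
have adjE x y : adj G x y -> U x = U y.
  move=> xy; have /psumr_eq0P s1 : \sum_z (U x - U z) ^+ 2 * ewt G x z = 0.
    by apply: s0 => // z _; apply: sumr_ge0.
  have /eqP := s1 (fun z _ => t_ge0 x z) y isT.
  by rewrite mulf_eq0 (gt_eqF (ewt_gt0 xy)) orbF sqrf_eq0 subr_eq0 => /eqP.
move=> x y /connectP[p pP ->] {y}.
elim: p x pP => //= z p IHp x /andP[xz zp].
by rewrite (adjE _ _ xz) (IHp _ zp).
Qed.

End Graph.

Section Boundary.
Variables (R : rcfType) (V : finType) (G : wgraph R V) (B : {set V}).

Definition interior : finType := {x : V | x \in ~: B}.

Definition restrict (U : {ffun V -> R}) : {ffun interior -> R} :=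
  [ffun x => U (val x)].

Definition misses_interior (x : V) : bool :=
  [forall y, connect (adj G) x y ==> (y \notin ~: B)].

(* The conditions that define N_0(u). *)
Definition is_neumann_ext (u : {ffun interior -> R}) : pred {ffun V -> R} :=
  fun U => [&& restrict U == u,
    [forall x in B, laplacian G U x == 0] &
    [forall x, misses_interior x ==> (U x == 0)]].

Lemma is_neumann_extP u U :
  reflect [/\ restrict U = u, (forall x, x \in B -> laplacian G U x = 0) &
              forall x, misses_interior x -> U x = 0]
          (is_neumann_ext u U).
Proof.
apply: (iffP and3P) => -[H1 H2 H3]; split.
- exact/eqP.
- by move=> x xB; apply/eqP; move/forall_inP: H2; apply.
- by move=> x hx; apply/eqP; move/forall_inP: H3; apply.
- exact/eqP.
- by apply/forall_inP => x xB; rewrite H2.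
- by apply/forall_inP => x hx; rewrite H3.
Qed.

Let W := {ffun V -> R^o}.

Let neumann_sys (U : W) : W :=
  [ffun x => if (x \in ~: B) || misses_interior x then U x
             else laplacian G U x].

Let neumann_sys_linear : linear neumann_sys.
Proof.
move=> a U U'; apply/ffunP => x; rewrite !ffunE; case: ifP => // _.
rewrite /GRing.scale /= mulrCA -mulrDr; congr (_ * _).
rewrite mulr_sumr -big_split; apply: eq_bigr => y _ /=.
by rewrite !ffunE /GRing.scale /= mulrA -mulrDl opprD addrACA mulrBr.
Qed.

HB.instance Definition _ :=
  GRing.isLinear.Build R W W _ neumann_sys neumann_sys_linear.

Let neumann_sys_ker (U : W) : neumann_sys U = 0 -> U = 0.
Proof.
move=> /ffunP h; have h0 x : U x * laplacian G U x = 0.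
  have := h x; rewrite [RHS]ffunE ffunE; case: ifP => _ ->.
    by rewrite mul0r.
  by rewrite mulr0.
have c := harmonic_constant h0.
apply/ffunP => x; rewrite [RHS]ffunE.
have [hx|/forallPn[y]] := boolP (misses_interior x).
  by have := h x; rewrite [RHS]ffunE ffunE hx orbT.
rewrite negb_imply negbK => /andP[xy yI]; rewrite (c _ _ xy).
by have := h y; rewrite [RHS]ffunE ffunE yI.
Qed.

Let neumann_sys_inj : lker (linfun neumann_sys) == 0%VS.
Proof.
rewrite -subv0; apply/subvP => U; rewrite memv_ker lfunE memv0 => /eqP.
by move/neumann_sys_ker/eqP.
Qed.

Lemma neumann_ext_exists u : exists U, is_neumann_ext u U.
Proof.
pose F : W := [ffun x => if insub x is Some z then u z else 0].
exists ((linfun neumann_sys)^-1%VF F).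
set U := (_^-1%VF F); have /ffunP UF : neumann_sys U = F.
  by rewrite -[LHS](lfunE neumann_sys) lker0_lfunVK.
have h1 : restrict U = u.
  apply/ffunP => z; rewrite ffunE; have := UF (val z).
  by rewrite ffunE (valP z) [RHS]ffunE valK.
have h3 x : misses_interior x -> U x = 0.
  move=> hx; have := UF x; rewrite ffunE hx orbT [RHS]ffunE insubF //.
  apply/negbTE; move/forallP/(_ x): hx; by rewrite connect0.
apply/is_neumann_extP; split=> // x xB.
have xI : x \in ~: B = false by rewrite inE xB.
have := UF x; rewrite ffunE xI [F x]ffunE insubF //=; case: ifP => // hx _.
rewrite ffunE big1 ?mulr0 // => y _; rewrite h3 //.
have [xy|/ewt_eq0->] := boolP (adj G x y); last by rewrite mulr0.
rewrite h3 ?subrr ?mul0r //; apply/forallP => z; apply/implyP => yz.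
by move/forallP/(_ z)/implyP: hx; apply; rewrite (connect_trans (connect1 xy)).
Qed.

Lemma neumann_ext_unique u U U' :
  is_neumann_ext u U -> is_neumann_ext u U' -> U = U'.
Proof.
move=> /is_neumann_extP[h1 h2 h3] /is_neumann_extP[h1' h2' h3'].
apply/eqP; rewrite -subr_eq0; apply/eqP/(@neumann_sys_ker (U - U' : W)).
rewrite -[LHS](lfunE neumann_sys) linearB /= !lfunE; apply/eqP.
rewrite subr_eq0; apply/eqP/ffunP => x; rewrite !ffunE.
have [xI /=|xI /=] := boolP (x \in ~: B).
  have /ffunP/(_ (Sub x xI)) : restrict U = restrict U' by rewrite h1 h1'.
  by rewrite !ffunE.
have xB : x \in B by move: xI; rewrite inE negbK.
case: ifP => hx; first by rewrite h3 ?h3'.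
by have := h2 x xB; have := h2' x xB; rewrite !ffunE => -> ->.
Qed.

Definition neumann_ext (u : {ffun interior -> R}) : {ffun V -> R} :=
  xchoose (neumann_ext_exists u).

Definition neumann_laplacian (u : {ffun interior -> R}) : {ffun interior -> R} :=
  restrict (laplacian G (neumann_ext u)).

End Boundary.

(* Main.v *)
(* Courant-Fischer with one test function. The energy of N_0(u) on V equals the
   quadratic form of Delta^N at u, because Delta N_0(u) vanishes on B. Among the
   combinations u of the first i Neumann eigenfunctions, choose u nonzero with
   U = N_0(u) orthogonal to the first i - 1 Laplacian eigenfunctions; then
     mu_i |U|_V^2 <= <U, Delta U>_V = <u, Delta^N u>_Omega
                  <= nu_i |u|_Omega^2 <= nu_i |U|_V^2.
   If mu_i = nu_i > 0, all of these are equalities: the last one forces U = 0 on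
   B, and the outer two make U and u eigenfunctions. *)

From mathcomp Require Import all_boot all_order all_fingroup all_algebra.
From mathcomp Require Import complex polyrcf reals ring lra.
(* Last, so that [restrict] is not the one of [complex]. *)
Require Import Defs.

Set Implicit Arguments.
Unset Strict Implicit.
Unset Printing Implicit Defensive.

Import Order.TTheory GRing.Theory Num.Theory.
Local Open Scope ring_scope.

(** Fewer linear conditions than unknowns; this supplies the coefficients of the test function. *)
Lemma ker_row_neq0 (F : fieldType) n k (K : 'M[F]_(n, k)) : (k < n)%N ->
  exists2 c : 'rV_n, c != 0 & c *m K = 0.
Proof.
move=> kn; have : kermx K != 0.
  rewrite kermx_eq0 -row_leq_rank -ltnNge.
  exact: leq_ltn_trans (rank_leq_col _) kn.
by case/rowV0Pn => c /sub_kermxP cK c0; exists c.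
Qed.

(** * Spectral theorem for a matrix self-adjoint with respect to a positive definite form *)

Section Spectral.
Variable R : rcfType.

Definition posdef n (M : 'M[R]_n) :=
  M^T = M /\ forall u : 'rV_n, u != 0 -> 0 < (u *m M *m u^T) 0 0.

(** Matrices act on row vectors from the right, so [A *m M = M *m A^T] is self-adjointness of [A]
    for the form u M v^T. An eigenvalue exists over the algebraic closure R[i]; self-adjointness
    makes it real, and then the real or the imaginary part of the eigenvector serves. *)
Lemma selfadjoint_eigenvector n (A M : 'M[R]_n) :
  (0 < n)%N -> posdef M -> A *m M = M *m A^T ->
  exists a, exists2 v : 'rV_n, v != 0 & v *m A = a *: v.
Proof.
move=> n_gt0 [_ Mpos] AM; pose toC := map_mx (real_complex R) (m:=n) (n:=n).
have [c] : exists c, root (char_poly (toC A)) c.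
  by apply/closed_rootP; rewrite size_char_poly eqSS -lt0n.
rewrite -eigenvalue_root_char => /eigenvalueP[w wA w0].
pose a := map_mx (@complex.Re R) w; pose b := map_mx (@complex.Im R) w.
pose x := complex.Re c; pose y := complex.Im c.
have ReD : {morph @complex.Re R : p q / p + q} by case=> [? ?] [].
have ImD : {morph @complex.Im R : p q / p + q} by case=> [? ?] [].
(* The real and imaginary parts of [w *m A = c *: w], with w = a + i b and c = x + i y. *)
have aA : a *m A = x *: a - y *: b.
  apply/rowP => j; have /rowP/(_ j)/(congr1 (@complex.Re R)) := wA.
  rewrite !mxE (big_morph _ ReD (erefl _)) /x /y.
  case: (c) (w 0 j) => [c1 c2] [w1 w2] /= <-; apply: eq_bigr => k _.
  by rewrite !mxE; case: (w 0 k) => w3 w4 /=; rewrite mulr0 subr0.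
have bA : b *m A = y *: a + x *: b.
  apply/rowP => j; have /rowP/(_ j)/(congr1 (@complex.Im R)) := wA.
  rewrite !mxE (big_morph _ ImD (erefl _)) /x /y.
  case: (c) (w 0 j) => [c1 c2] [w1 w2] /=; rewrite addrC => <-.
  apply: eq_bigr => k _.
  by rewrite !mxE; case: (w 0 k) => w3 w4 /=; rewrite mulr0 add0r.
have form_ge0 (u : 'rV_n) : 0 <= (u *m M *m u^T) 0 0.
  have [->|/Mpos/ltW//] := eqVneq u 0; by rewrite !mul0mx mxE.
have ab0 : (a != 0) || (b != 0).
  rewrite -negb_and; apply: contra w0 => /andP[/eqP a0 /eqP b0].
  move/rowP: a0 => a0; move/rowP: b0 => b0.
  apply/eqP/rowP => j; have := a0 j; have := b0 j; rewrite !mxE.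
  by case: (w 0 j) => p q /= -> ->.
(* <aA, b> = <a, bA> reads y (<a, a> + <b, b>) = 0. *)
have y0 : y = 0.
  have : ((a *m A) *m M *m b^T) 0 0 = (a *m M *m (b *m A)^T) 0 0.
    by rewrite trmx_mul -!mulmxA (mulmxA A) AM !mulmxA.
  have -> : (b *m A)^T = y *: a^T + x *: b^T by rewrite bA linearD !linearZ.
  rewrite aA !mulmxBl -!scalemxAl mulmxDr -!scalemxAr !mxE => E.
  apply/eqP; have {E} : y * ((a *m M *m a^T) 0 0 + (b *m M *m b^T) 0 0) = 0.
    by rewrite mulrDr; move: E; rewrite !mxE; lra.
  move/eqP; rewrite mulf_eq0 paddr_eq0 //; case/orP=> // /andP[a0 b0].
  by case/orP: ab0 => /Mpos; rewrite lt_neqAle eq_sym ?(eqP a0) ?(eqP b0) eqxx.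
have {}aA : a *m A = x *: a by rewrite aA y0 scale0r subr0.
have {}bA : b *m A = x *: b by rewrite bA y0 scale0r add0r.
by exists x; case/orP: ab0 => h; [exists a | exists b].
Qed.

(** Induction on [k]: the orthogonal complement of the eigenvectors found so far is nonzero and
    stable under [A], so it contains a further eigenvector, which is then normalized. *)
Lemma partial_eigenbasis n (A M : 'M[R]_n) k :
  posdef M -> A *m M = M *m A^T -> (k <= n)%N ->
  exists (P : 'M_(k, n)) (e : 'rV_k),
    P *m M *m P^T = 1%:M /\ P *m A = diag_mx e *m P.
Proof.
move=> Mpd AM; have [Msym Mpos] := Mpd.
elim: k => [|k IHk] kn.
  by exists 0, 0; rewrite !flatmx0; split=> //; apply: flatmx0.
have [P [e [PP PA]]] := IHk (ltnW kn).
(* [U] is the complement of the rows of [P] for the form [M], and [Q] is a basis of it. *)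
pose U := kermx (M *m P^T); pose Q := row_base U.
have QU : (Q <= U)%MS by rewrite eq_row_base.
have Ugt0 : (0 < \rank U)%N.
  rewrite mxrank_ker subn_gt0; apply: leq_ltn_trans kn; exact: rank_leq_col.
have UA : (U *m A <= U)%MS.
  apply/sub_kermxP; rewrite mulmxA -(mulmxA U) AM -!mulmxA -trmx_mul PA.
  by rewrite trmx_mul !mulmxA -(mulmxA U) mulmx_ker mul0mx.
(* [A'] is the restriction of [A] to [U] in the basis [Q]; the form restricts to the Gram matrix
   [Q *m M *m Q^T]. *)
have [A' QA] : exists A', Q *m A = A' *m Q.
  by apply/submxP; rewrite (eqmxMr _ (eq_row_base U)) eq_row_base UA.
have Qfree : row_free Q by exact: row_base_free.
clearbody Q.
have [||b [v v0 vA]] :=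
    @selfadjoint_eigenvector _ A' (Q *m M *m Q^T) Ugt0.
- split=> [|u u0]; first by rewrite !trmx_mul trmxK Msym mulmxA.
  have -> : u *m (Q *m M *m Q^T) *m u^T = u *m Q *m M *m (u *m Q)^T.
    by rewrite trmx_mul !mulmxA.
  apply: Mpos; by rewrite mulmx_free_eq0.
- by rewrite !mulmxA -QA -(mulmxA Q A) AM -!mulmxA -!trmx_mul QA.
pose z := v *m Q.
have z0 : z != 0 by rewrite mulmx_free_eq0.
have zA : z *m A = b *: z by rewrite -mulmxA QA mulmxA vA -scalemxAl.
have zP : z *m M *m P^T = 0.
  apply/eqP; rewrite -mulmxA -sub_kermx; exact: submx_trans (submxMl _ _) QU.
pose t := (Num.sqrt ((z *m M *m z^T) 0 0))^-1.
have t2 : t * t * (z *m M *m z^T) 0 0 = 1.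
  have zz := Mpos _ z0.
  by rewrite -expr2 exprVn sqr_sqrtr ?ltW // mulVf ?gt_eqF.
rewrite -add1n; exists (col_mx (t *: z) P), (row_mx (b%:M) e); split.
  rewrite tr_col_mx mul_col_mx mul_col_row PP.
  have -> : P *m M *m (t *: z)^T = 0.
    apply: trmx_inj; rewrite trmx0 trmx_mul trmxK trmx_mul Msym mulmxA.
    by rewrite -!scalemxAl zP scaler0.
  rewrite -!scalemxAl zP scaler0 linearZ -scalemxAr scalerA /=.
  by rewrite [z *m M *m _]mx11_scalar scale_scalar_mx t2 -scalar_mx_block.
rewrite mul_col_mx diag_mx_row mul_block_col !mul0mx addr0 add0r PA.
congr col_mx; rewrite -scalemxAl zA.
have -> : diag_mx (b%:M : 'rV_1) = b%:M.
  by apply/matrixP => i j; rewrite !mxE !ord1 !eqxx.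
by rewrite mul_scalar_mx !scalerA mulrC.
Qed.

(** * Characteristic polynomial and sorted list of eigenvalues *)

(** With D = [diag_mx e], the relation P A = D P gives P (X - A) = (X - D) P over the polynomials;
    take determinants and cancel the nonzero det P. *)
Lemma char_poly_eigenbasis n (A P : 'M[R]_n) (e : 'rV_n) :
  P \in unitmx -> P *m A = diag_mx e *m P ->
  char_poly A = \prod_i ('X - (e 0 i)%:P).
Proof.
move=> Pu PA; have -> : \prod_i ('X - (e 0 i)%:P) = char_poly (diag_mx e).
  rewrite char_poly_trig ?diag_mx_is_trig //.
  by apply: eq_bigr => i _; rewrite mxE eqxx.
have C : map_mx (@polyC R) P *m char_poly_mx A =
         char_poly_mx (diag_mx e) *m map_mx (@polyC R) P.
  by rewrite /char_poly_mx mulmxBr mulmxBl -!map_mxM PA scalar_mxC.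
have PC0 : \det (map_mx (@polyC R) P) != 0.
  by rewrite det_map_mx polyC_eq0 -unitfE -unitmxE.
apply: (mulfI PC0); rewrite [RHS]mulrC.
by move/(congr1 determinant): C; rewrite !det_mulmx.
Qed.

Lemma sorted_flatten_nseq (T : Type) (leT : rel T) (l : seq T) (h : T -> nat) :
  reflexive leT -> transitive leT -> sorted leT l ->
  sorted leT (flatten [seq nseq (h a) a | a <- l]).
Proof.
move=> refl tr; rewrite !sorted_pairwise //.
elim: l => //= a l IHl /andP[al pl]; rewrite pairwise_cat IHl // andbT.
apply/andP; split.
  elim: l al {IHl pl} => //= [_|b l IHl /andP[ab al]]; first exact: allrel0r.
  rewrite allrel_catr IHl // andbT.
  by rewrite /allrel all_nseq; apply/orP; right; rewrite /= all_nseq ab orbT.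
elim: (h a) => //= k ->; rewrite andbT; by rewrite all_nseq refl orbT.
Qed.

(** Both lists are sorted, so it suffices that every [x] occurs equally often in them: its count on
    the left is its multiplicity as a root, which is the number of factors X - x. *)
Lemma eigenvalues_prod (T : finType) (f : {ffun T -> R} -> {ffun T -> R}) s :
  char_poly (op_mx f) = \prod_(a <- s) ('X - a%:P) ->
  eigenvalues f = sort <=%R s.
Proof.
move=> fs; rewrite /eigenvalues fs; set p := \prod_(a <- s) _.
have p0 : p != 0 by rewrite monic_neq0 // monic_prod_XsubC.
have rootsE x : (x \in rootsR p) = (x \in s).
  by rewrite -(roots_on_rootsR p0) in_itv /= root_prod_XsubC.
apply: (sorted_eq le_trans le_anti).
- apply: sorted_flatten_nseq; [exact: lexx|exact: le_trans|].
  apply: sub_sorted (sorted_roots _ _ _); exact: ltW.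
- exact: sort_sorted le_total _.
rewrite perm_sym perm_sort perm_sym; apply/allP => x _ /=; apply/eqP.
rewrite count_flatten -map_comp sumnE big_map.
have [xs|xs] := boolP (x \in s).
  rewrite (bigD1_seq x) ?rootsE ?uniq_roots //= count_nseq /= eqxx mul1n.
  rewrite mu_prod_XsubC big1 ?addn0 // => a ax.
  by rewrite count_nseq /= (negPf ax).
rewrite big_seq big1 => [|a]; first by rewrite (count_memPn xs).
rewrite rootsE /= count_nseq /= => as_; have [ax|//] := eqVneq a x.
by rewrite -ax as_ in xs.
Qed.

End Spectral.

(** * Orthonormal eigenbases of operators on functions, for the inner product weighted by [m] *)

Section Eigenbasis.
Variables (R : rcfType) (T : finType) (m : T -> R).
Implicit Types (f : {ffun T -> R} -> {ffun T -> R}) (u v : {ffun T -> R}).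

Definition dot u v : R := \sum_x m x * u x * v x.

Lemma dotC u v : dot u v = dot v u.
Proof. by apply: eq_bigr => x _; rewrite mulrAC. Qed.

Lemma dot_suml (I : finType) (c : I -> R) (h : I -> {ffun T -> R}) v :
  dot [ffun x => \sum_i c i * h i x] v = \sum_i c i * dot (h i) v.
Proof.
under [RHS]eq_bigr do rewrite mulr_sumr.
rewrite exchange_big; apply: eq_bigr => x _ /=.
rewrite ffunE mulr_sumr mulr_suml.
by apply: eq_bigr => i _; rewrite mulrCA !mulrA.
Qed.

Hypothesis m_gt0 : forall x, 0 < m x.

Let dot_term_ge0 u x : 0 <= m x * u x * u x.
Proof. by rewrite -mulrA -expr2 mulr_ge0 ?sqr_ge0 // ltW. Qed.

Lemma dot_ge0 u : 0 <= dot u u.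
Proof. by apply: sumr_ge0 => x _. Qed.

Lemma dot_eq0 u : (dot u u == 0) = (u == 0).
Proof.
apply/eqP/eqP => [|->]; last by apply: big1 => x _; rewrite ffunE mulr0.
move/psumr_eq0P => u0; apply/ffunP => x; rewrite ffunE; apply/eqP.
have /eqP := u0 (fun x _ => dot_term_ge0 u x) x isT.
by rewrite -mulrA mulf_eq0 (gt_eqF (m_gt0 x)) mulf_eq0 orbb.
Qed.

Definition selfadjoint f := forall u v, dot (f u) v = dot u (f v).

(** Completeness is recorded as the Parseval identity. Indices start at 0 and match the list
    [eigenvalues f]; the bound [k < #|T|] keeps the default value of [nth] out of the comparison. *)
Record eigenbasis f (b : 'I_#|T| -> {ffun T -> R}) : Prop := {
  eigenbasis_ortho : forall j k, dot (b j) (b k) = (j == k)%:R;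
  eigenbasis_parseval :
    forall u v, dot u v = \sum_k dot u (b k) * dot v (b k);
  eigenbasis_eigen : forall k x, f (b k) x = (eigenvalues f)`_k * b k x;
  eigenbasis_sorted : forall j k : nat, (j <= k)%N -> (k < #|T|)%N ->
    (eigenvalues f)`_j <= (eigenvalues f)`_k
}.

Let rowv u : 'rV_#|T| := \row_j u (enum_val j).
Let M : 'M_#|T| := diag_mx (\row_j m (enum_val j)).

Let dot_mx u v : dot u v = (rowv u *m M *m (rowv v)^T) 0 0.
Proof.
rewrite mul_mx_diag mxE /dot (reindex _ (onW_bij _ (enum_val_bij T))).
by apply: eq_bigr => j _; rewrite !mxE (mulrC (m _)).
Qed.

Let rowv_surj (w : 'rV_#|T|) : rowv [ffun x => w 0 (enum_rank x)] = w.
Proof. by apply/rowP => j; rewrite mxE ffunE enum_valK. Qed.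

Let M_posdef : posdef M.
Proof.
split=> [|w w0]; first exact: tr_diag_mx.
rewrite -(rowv_surj w) -dot_mx lt_neqAle dot_ge0 andbT eq_sym dot_eq0.
apply: contra w0 => /eqP w0; apply/eqP; rewrite -(rowv_surj w) w0.
by apply/rowP => j; rewrite !mxE ffunE.
Qed.

Let delta (i : 'I_#|T|) : {ffun T -> R} := [ffun x => (x == enum_val i)%:R].

Let dot_delta u i : dot u (delta i) = m (enum_val i) * u (enum_val i).
Proof.
rewrite /dot (bigD1 (enum_val i)) //= big1 ?addr0 => [|x /negPf xi].
  by rewrite ffunE eqxx mulr1.
by rewrite ffunE xi mulr0.
Qed.

Let op_mx_selfadjoint f : selfadjoint f -> op_mx f *m M = M *m (op_mx f)^T.
Proof.
move=> fsa; rewrite mul_mx_diag mul_diag_mx; apply/matrixP => i j.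
by rewrite !mxE mulrC -!dot_delta -/(delta _) fsa dotC.
Qed.

(** Linearity of [f] comes from self-adjointness: pairing [f u] with [delta j] moves [f] onto
    [delta j], leaving an expression linear in [u]. *)
Let rowv_op f u : selfadjoint f -> rowv (f u) = rowv u *m op_mx f.
Proof.
move=> fsa; apply/rowP => j; rewrite !mxE.
have mj := m_gt0 (enum_val j); apply: (mulfI (lt0r_neq0 mj)).
rewrite -dot_delta fsa dot_mx /M mul_mx_diag mxE mulr_sumr.
apply: eq_bigr => k _; rewrite !mxE -mulrA [RHS]mulrCA; congr (_ * _).
by rewrite -!dot_delta -/(delta k) fsa dotC.
Qed.

Lemma selfadjoint_eigenbasis f : selfadjoint f -> exists b, eigenbasis f b.
Proof.
move=> fsa; have AM := op_mx_selfadjoint fsa.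
have [P [e [PP PA]]] := partial_eigenbasis M_posdef AM (leqnn _).
(* [P] is square, so orthonormality of its rows yields completeness; this is the source of
   Parseval. *)
have P1 : P^T *m (P *m M) = 1%:M by apply: mulmx1C.
have Pu : P \in unitmx by rewrite -mulmxA in PP; have [] := mulmx1_unit PP.
pose s := [tuple e 0 i | i < #|T|].
have fs : eigenvalues f = sort <=%R s.
  apply: eigenvalues_prod; rewrite (char_poly_eigenbasis Pu PA).
  by rewrite big_map big_enum.
(* The rows of [P] come in no particular order; [p] reindexes them along the sorted eigenvalues. *)
have /tuple_permP[p ps] : perm_eq (sort <=%R s) s by rewrite perm_sort.
have evE (k : 'I_#|T|) : (eigenvalues f)`_k = e 0 (p k).
  by rewrite fs ps -tnth_nth !tnth_mktuple.
pose b k : {ffun T -> R} := [ffun x => P (p k) (enum_rank x)].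
have rb k : rowv (b k) = row (p k) P.
  by apply/rowP => j; rewrite !mxE ffunE enum_valK.
have dotb u k : dot u (b k) = (rowv u *m M *m P^T) 0 (p k).
  rewrite dot_mx rb !mxE; apply: eq_bigr => j _; by rewrite !mxE.
exists b; split.
- move=> j k; rewrite dotb rb -!row_mul PP !mxE.
  by rewrite (inj_eq perm_inj).
- move=> u v; rewrite dot_mx -[M in LHS]mulmx1 -P1 !mulmxA.
  rewrite -(mulmxA _ P M) -(mulmxA _ (P *m M)).
  rewrite mxE (reindex_inj (@perm_inj _ p)); apply: eq_bigr => k _.
  rewrite -dotb; congr (_ * _); rewrite dotb.
  have -> (w : 'rV[R]_#|T|) : w 0 (p k) = w^T (p k) 0 :> R by rewrite mxE.
  by rewrite !trmx_mul tr_diag_mx trmxK !mulmxA.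
- move=> k x; have /rowP/(_ (enum_rank x)) := rowv_op (b k) fsa.
  rewrite rb -row_mul PA mul_diag_mx !mxE enum_rankK => ->.
  by rewrite evE [b k x]ffunE.
move=> j k jk kT; have sz : size (eigenvalues f) = #|T|.
  by rewrite fs size_sort size_tuple.
apply: (sorted_leq_nth le_trans lexx); rewrite ?inE ?sz ?(leq_ltn_trans jk) //.
by rewrite fs; apply: sort_sorted; exact: le_total.
Qed.

(* [s] is the sign that turns one argument into both Rayleigh inequalities. *)
Lemma rayleigh f b u (t s : R) : selfadjoint f -> eigenbasis f b -> s != 0 ->
  (forall k, dot u (b k) != 0 -> 0 <= s * ((eigenvalues f)`_k - t)) ->
  0 <= s * (dot u (f u) - t * dot u u) /\
  (dot u (f u) = t * dot u u -> forall x, f u x = t * u x).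
Proof.
move=> fsa fb s0 hk.
have fub (k : 'I_#|T|) : dot (f u) (b k) = (eigenvalues f)`_k * dot u (b k).
  rewrite fsa /dot mulr_sumr; apply: eq_bigr => x _.
  by rewrite (eigenbasis_eigen fb) mulrCA.
have E : s * (dot u (f u) - t * dot u u) =
    \sum_(k < #|T|) s * ((eigenvalues f)`_k - t) * dot u (b k) ^+ 2.
  rewrite (eigenbasis_parseval fb u (f u)) (eigenbasis_parseval fb u u).
  rewrite [t * _]mulr_sumr -sumrB mulr_sumr; apply: eq_bigr => k _.
  rewrite fub; ring.
have ge0 (k : 'I_#|T|) : 0 <= s * ((eigenvalues f)`_k - t) * dot u (b k) ^+ 2.
  have [->|/hk h] := eqVneq (dot u (b k)) 0; first by rewrite expr0n mulr0.
  by rewrite mulr_ge0 ?sqr_ge0.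
split=> [|ut]; first by rewrite E sumr_ge0.
move: E; rewrite ut subrr mulr0 => /esym/psumr_eq0P E.
(* Equality case: a sum of nonnegative terms vanishes, so for each [k] the eigenvalue is [t] or the
   coefficient of [u] is 0. Either way [w] has zero coefficient along [b k]. *)
pose w : {ffun T -> R} := [ffun x => f u x - t * u x].
have w_dot v : dot w v = dot (f u) v - t * dot u v.
  rewrite /dot mulr_sumr -sumrB; apply: eq_bigr => x _; rewrite ffunE; ring.
have w0 : w = 0.
  apply/eqP; rewrite -dot_eq0 (eigenbasis_parseval fb) big1 // => k _.
  have /eqP := E (fun k _ => ge0 k) k isT.
  rewrite !mulf_eq0 (negPf s0) /= orbb w_dot fub -mulrBl => /orP[|] /eqP ->.
    by rewrite !mul0r.
  by rewrite mulr0 mul0r.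
by move=> x; move/ffunP: w0 => /(_ x); rewrite !ffunE => /subr0_eq.
Qed.

End Eigenbasis.

(** * The Laplacian and the Neumann Laplacian as quadratic forms *)

Section Comparison.
Variables (R : rcfType) (V : finType) (G : wgraph R V) (B : {set V}).
Implicit Types (U W : {ffun V -> R}) (u v : {ffun interior B -> R}).

Let mI (z : interior B) := vmeas G (val z).
Local Notation dotV := (dot (vmeas G)).
Local Notation dotI := (dot mI).
Local Notation N0 := (neumann_ext G (B:=B)).

Lemma laplacian_selfadjoint : selfadjoint (vmeas G) (laplacian G).
Proof.
(* The first double sum is symmetric in [U] and [W] at once, the second after exchanging [x] and
   [y], as the weight is symmetric. *)
have E U W : dotV (laplacian G U) W =
    \sum_x \sum_y U x * W x * ewt G x y - \sum_x \sum_y U y * W x * ewt G x y.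
  rewrite -sumrB; apply: eq_bigr => x _; rewrite ffunE mulVKf; last first.
    by rewrite gt_eqF ?vmeas_gt0.
  rewrite -sumrB mulr_suml; apply: eq_bigr => y _; ring.
move=> U W; rewrite [RHS]dotC !E; congr (_ - _).
  by apply: eq_bigr => x _; apply: eq_bigr => y _; rewrite (mulrC (U x)).
rewrite exchange_big; apply: eq_bigr => x _; apply: eq_bigr => y _ /=.
by rewrite ewt_sym (mulrC (U x)).
Qed.

Lemma laplacian_ge0 U : 0 <= dotV U (laplacian G U).
Proof.
have -> : dotV U (laplacian G U) = \sum_x U x * laplacian G U x * vmeas G x.
  by apply: eq_bigr => x _; rewrite [RHS]mulrC mulrA.
rewrite dirichlet_energy mulr_ge0 ?invr_ge0 ?ler0n //.
apply: sumr_ge0 => x _; apply: sumr_ge0 => y _; rewrite mulr_ge0 ?sqr_ge0 //.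
by have [/ewt_gt0/ltW//|/ewt_eq0->] := boolP (adj G x y).
Qed.

Lemma dot_restrict U W :
  dotV U W = dotI (restrict B U) (restrict B W)
             + \sum_(x in B) vmeas G x * U x * W x.
Proof.
rewrite /dot (bigID (mem (~: B))) /=; congr (_ + _).
  by rewrite big_sub; apply: eq_bigr => z _; rewrite !ffunE.
by apply: eq_bigl => x; rewrite inE negbK.
Qed.

Lemma neumann_extP u : [/\ restrict B (N0 u) = u,
  (forall x, x \in B -> laplacian G (N0 u) x = 0) &
  forall x, misses_interior G B x -> N0 u x = 0].
Proof. exact/is_neumann_extP/(xchooseP (neumann_ext_exists G u)). Qed.

(** The part of the pairing over [B] vanishes because [N0 u] is harmonic there. Self-adjointness and
    nonnegativity thus pass from the Laplacian to the Neumann Laplacian. *)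
Lemma neumann_laplacian_dot u v :
  dotI (neumann_laplacian G u) v = dotV (laplacian G (N0 u)) (N0 v).
Proof.
have [_ u0 _] := neumann_extP u; have [vE _ _] := neumann_extP v.
rewrite dot_restrict vE big1 ?addr0 // => x xB.
by rewrite u0 // mulr0 mul0r.
Qed.

Lemma neumann_laplacian_selfadjoint :
  selfadjoint mI (@neumann_laplacian R V G B).
Proof.
move=> u v; rewrite dotC [RHS]dotC.
rewrite [RHS]neumann_laplacian_dot dotC neumann_laplacian_dot dotC.
by rewrite -laplacian_selfadjoint dotC.
Qed.

(** [N0] is a chosen witness, so its linearity is drawn from uniqueness: the combination of the
    extensions meets the defining conditions. *)
Lemma neumann_ext_lincomb (I : finType) (c : I -> R)
    (h : I -> {ffun interior B -> R}) :
  N0 [ffun z => \sum_i c i * h i z] = [ffun x => \sum_i c i * N0 (h i) x].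
Proof.
apply: (@neumann_ext_unique _ _ G B [ffun z => \sum_i c i * h i z]).
  exact: (xchooseP (neumann_ext_exists G _)).
apply/is_neumann_extP; split.
- apply/ffunP => z; rewrite !ffunE; apply: eq_bigr => i _.
  have [hE _ _] := neumann_extP (h i).
  by rewrite -[in RHS]hE ffunE.
- move=> x xB; rewrite ffunE.
  have -> : \sum_y ([ffun x => \sum_i c i * N0 (h i) x] x -
      [ffun x => \sum_i c i * N0 (h i) x] y) * ewt G x y =
      \sum_i c i * \sum_y (N0 (h i) x - N0 (h i) y) * ewt G x y.
    under [RHS]eq_bigr do rewrite mulr_sumr.
    rewrite exchange_big; apply: eq_bigr => y _ /=; rewrite !ffunE.
    by rewrite -sumrB mulr_suml; apply: eq_bigr => i _; ring.
  rewrite mulr_sumr big1 // => i _.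
  have [_ /(_ x xB) + _] := neumann_extP (h i).
  by rewrite ffunE mulrCA => ->; rewrite mulr0.
move=> x hx; rewrite ffunE big1 // => i _.
by have [_ _ ->] := neumann_extP (h i); rewrite ?mulr0.
Qed.

(* [k + 1] Neumann modes against [k] orthogonality conditions. *)
Lemma test_function k (a : nat -> {ffun V -> R})
    (phi : 'I_#|{: interior B}| -> {ffun interior B -> R}) :
  (forall i j, dotI (phi i) (phi j) = (i == j)%:R) ->
  (k < #|{: interior B}|)%N ->
  exists u, [/\ u != 0, forall j, (j < k)%N -> dotV (N0 u) (a j) = 0 &
    forall j : 'I_#|{: interior B}|, (k < j)%N -> dotI u (phi j) = 0].
Proof.
move=> ortho kn; pose w (i : 'I_k.+1) := widen_ord kn i.
pose K : 'M_(k.+1, k) := \matrix_(i, j) dotV (N0 (phi (w i))) (a j).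
have [c c0 cK] := ker_row_neq0 K (ltnSn k).
pose u : {ffun interior B -> R} := [ffun z => \sum_i c 0 i * phi (w i) z].
have uphi j : dotI u (phi j) = \sum_i c 0 i * (w i == j)%:R.
  by rewrite dot_suml; apply: eq_bigr => i _; rewrite ortho.
exists u; split.
(* By orthonormality the pairing of [u] with [phi (w i)] is the coefficient [c 0 i], so [u = 0]
   would force [c = 0]. *)
- apply: contra c0 => /eqP u0; apply/eqP/rowP => i; rewrite mxE.
  have := uphi (w i); rewrite u0 /dot big1 => [|z _]; last first.
    by rewrite ffunE mulr0 mul0r.
  rewrite (bigD1 i) //= eqxx mulr1 big1 ?addr0 // => j /negPf ji.
  suff -> : (w j == w i) = false by rewrite mulr0.
  by rewrite -ji -!val_eqE.
- move=> j jk; rewrite neumann_ext_lincomb dot_suml.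
  move/rowP: cK => /(_ (Ordinal jk)); rewrite !mxE => cK; rewrite -[RHS]cK.
  by apply: eq_bigr => i _; rewrite mxE.
move=> j kj; rewrite uphi big1 // => i _.
suff -> : (w i == j) = false by rewrite mulr0.
by apply/negbTE; rewrite -val_eqE /= neq_ltn (leq_ltn_trans _ kj) // -ltnS.
Qed.

(** * Comparison of the eigenvalues *)

Local Notation mu := (eigenvalues (laplacian G)).
Local Notation nu := (eigenvalues (@neumann_laplacian R V G B)).

Lemma neumann_comparison k : (k < #|{: interior B}|)%N ->
  mu`_k <= nu`_k /\ (mu`_k = nu`_k -> 0 < nu`_k ->
    exists U, [/\ forall x, x \in B -> U x = 0 /\ laplacian G U x = 0,
      restrict B U != 0, forall x, laplacian G U x = mu`_k * U x &
      forall z, neumann_laplacian G (restrict B U) z = nu`_k * restrict B U z]).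
Proof.
move=> kI; have mI_gt0 z : 0 < mI z by exact: vmeas_gt0.
have kV : (k < #|V|)%N.
  by apply: leq_trans kI _; rewrite card_sig; exact: max_card.
have Lsa := laplacian_selfadjoint; have Nsa := neumann_laplacian_selfadjoint.
have [a aP] := selfadjoint_eigenbasis (vmeas_gt0 G) Lsa.
have [phi phiP] := selfadjoint_eigenbasis mI_gt0 Nsa.
pose a' (j : nat) := if insub j is Some i then a i else 0.
have [u [u0 ua uphi]] := test_function a' (eigenbasis_ortho phiP) kI.
have [uE u_harm _] := neumann_extP u; set U := N0 u in uE u_harm ua.
have energyE v :
    dotI v (neumann_laplacian G v) = dotV (N0 v) (laplacian G (N0 v)).
  by rewrite dotC neumann_laplacian_dot dotC.
(* The value is the energy of a normalized eigenfunction. Its sign is what allows replacing the norm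
   of [u] by the larger norm of [U] in the upper bound. *)
have nu_ge0 : 0 <= nu`_k.
  pose p := phi (Ordinal kI).
  have <- : dotI p (neumann_laplacian G p) = nu`_k.
    transitivity (nu`_k * dotI p p); last first.
      by rewrite (eigenbasis_ortho phiP) eqxx mulr1.
    rewrite /dot mulr_sumr; apply: eq_bigr => z _.
    by rewrite (eigenbasis_eigen phiP) mulrCA.
  by rewrite energyE laplacian_ge0.
(* [U] has no Laplacian modes below [k], which gives the lower bound on its energy. *)
have [||low lowE] :=
    rayleigh (u := U) (t := mu`_k) (s := 1) (vmeas_gt0 G) Lsa aP.
- exact: oner_neq0.
- move=> j Uj; rewrite mul1r subr_ge0 (eigenbasis_sorted aP) // leqNgt.
  by apply: contra Uj => jk; have := ua _ jk; rewrite /a' valK => ->.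
(* [u] has no Neumann modes above [k]; the sign -1 gives the upper bound. *)
have [||upp uppE] :=
    rayleigh (u := u) (t := nu`_k) (s := -1) mI_gt0 Nsa phiP.
- by rewrite oppr_eq0 oner_neq0.
- move=> j uj; rewrite mulN1r opprB subr_ge0 (eigenbasis_sorted phiP) //.
  by rewrite leqNgt; apply: contra uj => kj; rewrite uphi.
rewrite energyE -/U in upp uppE.
(* [r] is the mass of [U] on the boundary, the gap between the two squared norms. *)
have nU := dot_restrict U U; rewrite uE in nU; set r := \sum_(x in B) _ in nU.
have r_ge0 x : x \in B -> 0 <= vmeas G x * U x * U x.
  by move=> _; rewrite -mulrA -expr2 mulr_ge0 ?sqr_ge0 // ltW ?vmeas_gt0.
have r0 : 0 <= r by apply: sumr_ge0.
have u_gt0 : 0 < dotI u u by rewrite lt_neqAle dot_ge0 // eq_sym dot_eq0 // u0.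
split=> [|muE nu_gt0].
  have : (nu`_k - mu`_k) * dotV U U >= 0 by move: nu_ge0 r0; nra.
  by rewrite pmulr_lge0 ?subr_ge0 // nU; lra.
(* With equal eigenvalues the two bounds leave nu r <= 0, and nu is positive. *)
have req : r = 0 by rewrite muE in low; nra.
rewrite req addr0 in nU; rewrite muE nU in low lowE *.
have UE : dotV U (laplacian G U) = nu`_k * dotI u u by lra.
exists U; rewrite uE; split=> //; [|exact: lowE|exact: uppE].
move=> x xB; split; last exact: u_harm.
move/psumr_eq0P: req => /(_ r_ge0 x xB)/eqP.
by rewrite -mulrA mulf_eq0 (gt_eqF (vmeas_gt0 G x)) mulf_eq0 orbb => /eqP.
Qed.

End Comparison.

Theorem theorem1p1 (R : realType) (V : finType) (G : wgraph R V) (B : {set V})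
    (hB : B != set0) :
  let mu := nth_eigenvalue (laplacian G) in
  let nu := nth_eigenvalue (@neumann_laplacian R V G B) in
  (forall i : nat, (1 <= i <= #|~: B|)%N -> mu i <= nu i) /\
  (forall i : nat, (2 <= i <= #|~: B|)%N -> mu i = nu i -> 0 < nu i ->
    exists u : {ffun V -> R},
      [/\ forall x, x \in B -> u x = 0 /\ normal_derivative G u x = 0,
          restrict B u != 0,
          is_eigenfunction (laplacian G) (mu i) u &
          is_eigenfunction (@neumann_laplacian R V G B) (nu i) (restrict B u)]).
Proof.
move=> mu nu; have cardI : #|{: interior B}| = #|~: B| by rewrite card_sig.
(* The range excludes index 0; writing the index as [i.+1] turns it into position [i] of the
   zero-based lists. *)
split=> -[//|i] /andP[i_gt0 iI].
  by have [|+ _] := @neumann_comparison R V G B i; rewrite ?cardI.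
move=> muE nu_gt0; have [|_ H] := @neumann_comparison R V G B i.
  by rewrite cardI.
have [u [uB u0 uL uN]] := H muE nu_gt0.
exists u; split=> //.
- by move=> x xB; have [uB0 + ] := uB x xB; rewrite ffunE.
split=> //; apply: contra u0 => /eqP ->.
by apply/eqP/ffunP => z; rewrite !ffunE.
Qed.
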